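(* Let $s\mapsto x^i(s)$ be the smooth trajectory of a material particle in Minkowski space $M_4$, parameterised by proper time $s$, with unit time-like tangent vector $u^i(s)=dx^i/ds$. Let $(\mathbf e_a(s))_{a=0,\dots,3}$ be a smooth family of orthonormal tetrads along the trajectory, with components $e_a{}^i(s)$ and $\mathbf e_0(s)=u(s)$, which is transported along the trajectory by the infinitesimal boosts sending $u(s)$ to $u(s)+\dot u(s)\,ds$, i.e. $$\dot e_a{}^i(s)=\frac{d}{ds'}\Big|_{s'=s}B\big(u(s'),u(s)\big)^i{}_j\,e_a{}^j(s)\qquad(a=0,\dots,3).$$ Then any vector $p^i(s)=p^a e_a{}^i(s)$ moving along the trajectory with constant coefficients $p^a$ (a comoving vector) evolves according to $$\dot p^i=(u^i\dot u_j-u_j\dot u^i)\,p^j .$$ In other words, $p^i$ is Fermi--Walker-propagated along the curve tangent to $u(s)$.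
   Context: $M_4$ is Minkowski space with Cartesian coordinates $(x^i)_{i=0,\dots,3}$ and metric $\eta_{ij}=\mathrm{diag}(-1,1,1,1)$; indices are lowered and raised with $\eta$, repeated indices are summed, and $x\cdot y=\eta_{ij}x^iy^j$. A dot over a quantity denotes $d/ds$. A tetrad $(\mathbf e_a)$ is orthonormal if $\mathbf e_a\cdot\mathbf e_b=\eta_{ab}$; in particular $u\cdot u=-1$. For two future-directed (same time-orientation) unit time-like vectors $u,v$ (so $u\cdot u=v\cdot v=-1$), the boost, or special Lorentz transformation, $B(v,u)$ is the linear map sending $u$ to $v$ and leaving invariant the plane orthogonal to both $u$ and $v$; it is given by $$B(v,u)^i{}_j=\delta^i{}_j+\frac{(v^i+u^i)(v_j+u_j)}{1+\gamma}-2v^iu_j,\qquad \gamma=-v\cdot u .$$ *)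

(* Defs.v *)
From HB Require Import structures.
From mathcomp Require Import all_boot all_order all_algebra.
From mathcomp Require Import ring.
From mathcomp Require Import all_classical all_reals all_analysis.

Set Implicit Arguments.
Unset Strict Implicit.
Unset Printing Implicit Defensive.
Import Order.TTheory GRing.Theory Num.Theory.
Import numFieldNormedType.Exports.
Local Open Scope classical_set_scope.
Local Open Scope ring_scope.

(* Contravariant components x^i (i = 0, .., 3) are the entries [x i 0] of a
   column vector x : 'cV[R]_4; lower-index components are the entries of
   [lower x]. *)

Definition minkowski_metric (R : realType) : 'M[R]_4 :=
  diag_mx (\row_(i < 4) if i == 0 then -1 else 1).

Definition mdot (R : realType) (x y : 'cV[R]_4) : R :=
  \sum_(i < 4) \sum_(j < 4) minkowski_metric R i j * x i 0 * y j 0.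

Definition lower (R : realType) (x : 'cV[R]_4) : 'cV[R]_4 :=
  \col_(i < 4) \sum_(j < 4) minkowski_metric R i j * x j 0.

Definition orthonormal_tetrad (R : realType) (e : 'I_4 -> 'cV[R]_4) : Prop :=
  forall a b : 'I_4, mdot (e a) (e b) = minkowski_metric R a b.

Definition boost (R : realType) (v u : 'cV[R]_4) : 'M[R]_4 :=
  let gamma := - mdot v u in
  \matrix_(i < 4, j < 4)
    ((i == j)%:R
     + (v i 0 + u i 0) * (lower v j 0 + lower u j 0) / (1 + gamma)
     - 2 * v i 0 * lower u j 0).

(* On an open set J the iterated derivatives at points of J only depend on the
   values of f on J, so nothing is required of f outside J. *)
Definition smooth_on (R : realType) (V : normedModType R) (J : set R)
    (f : R -> V) : Prop :=
  forall (n : nat) (s : R), J s -> derivable (derive1n n f) s 1.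

(* D_F p / ds = dp/ds - u (du/ds . p) + du/ds (u . p), for the signature
   (-, +, +, +). *)
Definition fermi_walker_derivative (R : realType) (u p : R -> 'cV[R]_4)
    (s : R) : 'cV[R]_4 :=
  derive1 p s - mdot (derive1 u s) (p s) *: u s + mdot (u s) (p s) *: derive1 u s.

Definition fermi_walker_propagated (R : realType) (J : set R)
    (u p : R -> 'cV[R]_4) : Prop :=
  forall s : R, J s ->
    derivable p s 1 /\ fermi_walker_derivative u p s = 0.

Lemma metric_sym (R : realType) (i j : 'I_4) :
  minkowski_metric R i j = minkowski_metric R j i.
Proof.
case: (eqVneq i j) => [-> //|ij].
by rewrite !mxE (negbTE ij) [j == i]eq_sym (negbTE ij).
Qed.

Lemma mdotE (R : realType) (x y : 'cV[R]_4) :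
  mdot x y = \sum_(j < 4) lower x j 0 * y j 0.
Proof.
rewrite /mdot exchange_big; apply: eq_bigr => j _; rewrite mxE mulr_suml.
apply: eq_bigr => i _; congr (_ * _ * _).
exact: metric_sym.
Qed.

Lemma mdotC (R : realType) (x y : 'cV[R]_4) : mdot x y = mdot y x.
Proof.
rewrite /mdot exchange_big; apply: eq_bigr => j _; apply: eq_bigr => i _.
rewrite mulrAC; congr (_ * _ * _).
exact: metric_sym.
Qed.

Lemma boost_mulmx (R : realType) (v u w : 'cV[R]_4) :
  boost v u *m w =
    w + ((mdot v w + mdot u w) / (1 - mdot v u)) *: (v + u)
      - (2 * mdot u w) *: v.
Proof.
apply/colP => i; rewrite !mxE !mdotE.
pose g := 1 - mdot v u.
transitivity (\sum_(j < 4) ((i == j)%:R * w j 0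
   + ((v i 0 + u i 0) / g) * (lower v j 0 * w j 0 + lower u j 0 * w j 0)
   - 2 * v i 0 * (lower u j 0 * w j 0))).
  by apply: eq_bigr => j _; rewrite mxE /g; ring.
rewrite sumrB big_split /= -!mulr_sumr big_split /=.
rewrite (bigD1 i) //= eqxx mul1r big1 ?addr0; last first.
  by move=> j ji; rewrite eq_sym (negbTE ji) mul0r.
by rewrite -(mdotE v u) -/g; ring.
Qed.

Lemma boost_source (R : realType) (v u : 'cV[R]_4) :
  mdot u u = -1 -> 1 - mdot v u != 0 -> boost v u *m u = v.
Proof.
move=> uu g0; rewrite boost_mulmx uu.
apply/colP => i; rewrite !mxE; field.
exact: g0.
Qed.

Lemma boost_fixed_plane (R : realType) (v u w : 'cV[R]_4) :
  mdot u w = 0 -> mdot v w = 0 -> boost v u *m w = w.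
Proof.
by move=> uw vw; rewrite boost_mulmx uw vw addr0 mul0r mulr0 !scale0r addr0 subr0.
Qed.

(* Main.v *)
(* Differentiating u . u = -1 gives du/ds . u = 0, so gamma is stationary at
   s' = s and the derivative there of B(u(s'), u(s))^i_j is
   u^i (du/ds)_j - u_j (du/ds)^i. This antisymmetric generator is the same for
   all four tetrad vectors, hence acts on their constant-coefficient
   combinations. *)
Require Import Defs.
From HB Require Import structures.
From mathcomp Require Import all_boot all_order all_algebra.
From mathcomp Require Import ring.
From mathcomp Require Import all_classical all_reals all_analysis.

Set Implicit Arguments.
Unset Strict Implicit.
Unset Printing Implicit Defensive.
Import Order.TTheory GRing.Theory Num.Theory.
Import numFieldNormedType.Exports.
Local Open Scope classical_set_scope.
Local Open Scope ring_scope.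

Section MinkowskiDerivatives.
Variables (R : realType) (s : R).

Lemma is_derive_entry (f : R -> 'cV[R]_4) (df : 'cV[R]_4) (i : 'I_4) :
  is_derive s 1 f df -> is_derive s 1 (fun t => f t i 0) (df i 0).
Proof.
move=> [fd <-]; apply: DeriveDef; first by move/derivable_mxP : fd; apply.
by rewrite derive_mx// mxE.
Qed.

Lemma is_derive_lower (f : R -> 'cV[R]_4) (df : 'cV[R]_4) (j : 'I_4) :
  is_derive s 1 f df ->
  is_derive s 1 (fun t => lower (f t) j 0) (lower df j 0).
Proof.
move=> fd.
have -> : (fun t => lower (f t) j 0) =
    \sum_(k < 4) (minkowski_metric R j k \*: (fun t => f t k 0)).
  by apply/funext => t; rewrite mxE fct_sumE.
rewrite mxE; apply: is_derive_sum => k; apply: is_deriveZ.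
exact: is_derive_entry.
Qed.

Lemma is_derive_mdot (f g : R -> 'cV[R]_4) (df dg : 'cV[R]_4) :
  is_derive s 1 f df -> is_derive s 1 g dg ->
  is_derive s 1 (fun t => mdot (f t) (g t)) (mdot df (g s) + mdot (f s) dg).
Proof.
move=> fd gd.
have -> : (fun t => mdot (f t) (g t)) =
    \sum_(j < 4) ((fun t => lower (f t) j 0) * (fun t => g t j 0)).
  by apply/funext => t; rewrite mdotE fct_sumE.
rewrite !mdotE -big_split /=; apply: is_derive_sum => j.
apply: is_derive_eq.
  exact: is_deriveM (is_derive_lower j fd) (is_derive_entry j gd).
by rewrite mulrC addrC.
Qed.

(** At [t = s] the product rule on the quotient gives the symmetric [u^i a_j + a^i u_j], since the
    denominator is stationary there with value 2. The term [- 2 v^i u_j] contributes [- 2 a^i u_j],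
    which makes the sum antisymmetric. *)
Lemma is_derive_boost (u : R -> 'cV[R]_4) (a : 'cV[R]_4) (i j : 'I_4) :
  is_derive s 1 u a -> mdot (u s) (u s) = -1 -> mdot a (u s) = 0 ->
  is_derive s 1 (fun t => boost (u t) (u s) i j)
    (u s i 0 * lower a j 0 - lower (u s) j 0 * a i 0).
Proof.
move=> ud uu au.
(* [g] is the denominator [1 + gamma]. As [u s] is frozen, its derivative at [s] is
   [- mdot a (u s)], hence zero. *)
pose g t := 1 - mdot (u t) (u s).
have gs : g s = 2 by rewrite /g uu opprK.
have gd : is_derive s 1 g 0.
  apply: is_derive_eq.
    apply: is_deriveB (is_derive_cst (1 : R) s 1) _.
    exact: is_derive_mdot ud (is_derive_cst (u s) s 1).
  by rewrite au [mdot _ 0]mdotE big1 ?addr0 ?subr0// => k _; rewrite [X in _ * X]mxE mulr0.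
have ui := is_derive_entry i ud.
have lj := is_derive_lower j ud.
have g0 : g s != 0 by rewrite gs.
have gVd := is_deriveV g0 gd.
pose d := (i == j)%:R : R.
(* The entry is regrouped into functions whose derivatives [ui], [lj], [gVd] are in context, so that
   its own derivative is found by instance resolution. *)
have -> : (fun t => boost (u t) (u s) i j) =
  cst d + ((fun t => u t i 0) + cst (u s i 0)) *
    ((fun t => lower (u t) j 0) + cst (lower (u s) j 0)) * (fun t => (g t)^-1)
  - (2 * lower (u s) j 0) \*: (fun t => u t i 0).
  apply/funext => t; rewrite mxE !fctE; congr (_ + _ - _).
  by rewrite /= mulrAC.
apply: is_derive_eq.
have scaleE (k b : R) : k *: (b : R^o) = k * b by [].
by rewrite !scaler0 !scaleE !fctE !gs !addr0; field.
Qed.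

End MinkowskiDerivatives.

Theorem theorem1 (R : realType) (J : set R)
    (J_open : open J) (J_interval : is_interval J)
    (x u : R -> 'cV[R]_4)
    (x_smooth : smooth_on J x)
    (u_tangent : forall s : R, J s -> u s = derive1 x s)
    (u_unit : forall s : R, J s -> mdot (u s) (u s) = -1)
    (e : 'I_4 -> R -> 'cV[R]_4)
    (e_smooth : forall a : 'I_4, smooth_on J (e a))
    (e_orthonormal : forall s : R, J s -> orthonormal_tetrad (fun a => e a s))
    (e0_tangent : forall s : R, J s -> e 0 s = u s)
    (e_transported : forall s : R, J s -> forall a i : 'I_4,
      derive1 (e a) s i 0 =
        \sum_(j < 4) derive1 (fun s' : R => boost (u s') (u s) i j) s * e a s j 0)
    (c : 'I_4 -> R) (p : R -> 'cV[R]_4)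
    (p_comoving : forall s : R, J s -> p s = \sum_(a < 4) c a *: e a s) :
  (forall s : R, J s -> derivable p s 1 /\
    forall i : 'I_4,
      derive1 p s i 0 =
        \sum_(j < 4) (u s i 0 * lower (derive1 u s) j 0
                      - lower (u s) j 0 * derive1 u s i 0) * p s j 0) /\
  fermi_walker_propagated J u p.
Proof.
(* The hypotheses hold only on [J]; openness makes them hold near each [s], as differentiating them
   requires. *)
have J_near s : J s -> \forall t \near s, J t by move=> Js; exact: open_nbhs_nbhs.
have e_derive a s (Js : J s) : is_derive s 1 (e a) (derive1 (e a) s).
  by rewrite derive1E; apply: derivableP; exact: (e_smooth a 0).
have u_derive s (Js : J s) : is_derive s 1 u (derive1 u s).
  rewrite derive1E; apply: derivableP.
  (* [u] inherits derivability from [e 0], with which it agrees near [s]; order 0 of smoothness is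
     derivability of [e 0] itself. *)
  apply: (@near_eq_derivable _ _ _ (e 0)); last exact: (e_smooth 0 0).
  by apply: filterS (J_near _ Js) => t; exact: e0_tangent.
have u_orth s (Js : J s) : mdot (derive1 u s) (u s) = 0.
  have [_ D] := is_derive_mdot (u_derive _ Js) (u_derive _ Js).
  (* [mdot u u] is constant near [s], and by symmetry its derivative is twice the product sought. *)
  have : 'D_1 (fun t => mdot (u t) (u t)) s = 'D_1 (cst (-1 : R)) s.
    by apply: near_eq_derive; apply: filterS (J_near _ Js) => t; exact: u_unit.
  rewrite D derive_cst [mdot (u s) _]mdotC -mulr2n => /eqP.
  by rewrite mulrn_eq0 => /eqP.
have p_derive s (Js : J s) :
    is_derive s 1 p (\sum_(a < 4) c a *: derive1 (e a) s).
  apply: (@near_eq_is_derive _ _ _ (\sum_(a < 4) (c a \*: e a))).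
    apply: filterS (J_near _ Js) => t /p_comoving ->.
    by rewrite fct_sumE.
  by apply: is_derive_sum => a; apply: is_deriveZ; exact: e_derive.
have p_evol s (Js : J s) (i : 'I_4) : derive1 p s i 0 =
    \sum_(j < 4) (u s i 0 * lower (derive1 u s) j 0
                  - lower (u s) j 0 * derive1 u s i 0) * p s j 0.
  have [_ D] := p_derive _ Js.
  rewrite derive1E D summxE p_comoving//.
  under eq_bigr => a _.
    rewrite mxE e_transported// mulr_sumr.
    under eq_bigr => j _.
      have [_ B] :=
        is_derive_boost i j (u_derive _ Js) (u_unit _ Js) (u_orth _ Js).
      rewrite derive1E B mulrCA.
      over.
    over.
  (* The generator does not depend on [a]: once the sums are swapped it factors out, and the sum
     over [a] rebuilds [p s]. *)
  rewrite exchange_big; apply: eq_bigr => j _.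
  by rewrite -mulr_sumr summxE; congr (_ * _); apply: eq_bigr => a _; rewrite mxE.
split=> s Js; have [pd _] := p_derive _ Js; split=> //; first exact: p_evol.
apply/colP => i; rewrite !mxE p_evol// !mdotE.
(* The sum splits into [u^i] times [mdot (derive1 u s) (p s)] minus the derivative of [u^i] times
   [mdot (u s) (p s)], which the two Fermi-Walker correction terms cancel. *)
under eq_bigr => j _ do rewrite mulrBl -mulrA mulrAC.
by rewrite sumrB -mulr_sumr -mulr_suml; ring.
Qed.
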